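(* Let $t,n$ be integers with $t>1$ (and $t\le n$). For every graph $G\in \mathscr{L}_{n,t}\setminus\{T_{n,t}\}$ one has $G\prec_s T_{n,t}$.
   Context: All graphs are finite, simple and connected, and are considered up to isomorphism. For $2\le t\le n$, $\mathscr{L}_{n,t}$ is the set of all $n$-vertex connected graphs with clique number $t$. $T_{n,t}$ is the Turán graph: the complete $t$-partite graph on $n$ vertices whose part sizes differ pairwise by at most one. For an $n$-vertex graph $G$ with adjacency eigenvalues $\lambda_1(G),\dots,\lambda_n(G)$, the $k$th spectral moment is $S_k(G)=\sum_{i=1}^n\lambda_i(G)^k$, $k=0,1,\dots,n-1$. For two $n$-vertex graphs $G_1,G_2$ write $G_1\prec_s G_2$ ($G_1$ comes before $G_2$ in the $S$-order) if for some $k$ with $1\le k\le n-1$ we have $S_i(G_1)=S_i(G_2)$ for $i=0,1,\dots,k-1$ and $S_k(G_1)<S_k(G_2)$. *)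

(* Defs.v *)
From mathcomp Require Import all_boot all_order all_algebra all_field.
From mathcomp Require Import zify.

Set Implicit Arguments.
Unset Strict Implicit.
Unset Printing Implicit Defensive.

Import Order.TTheory GRing.Theory Num.Theory.

Record sgraph (n : nat) := SGraph {
  adj :> rel 'I_n;
  adj_sym : symmetric adj;
  adj_irr : irreflexive adj
}.

Definition graph_iso n (G H : sgraph n) : Prop :=
  exists2 f : 'I_n -> 'I_n, bijective f & forall x y, H (f x) (f y) = G x y.

(* The empty graph would count as connected; it is excluded below because
   2 <= t <= n. *)
Definition connected_graph n (G : sgraph n) : Prop :=
  forall x y : 'I_n, connect G x y.

Definition is_clique n (G : sgraph n) (A : {set 'I_n}) : bool :=
  [forall x in A, forall y in A, (x != y) ==> G x y].

Definition clique_number n (G : sgraph n) : nat :=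
  \max_(A : {set 'I_n} | is_clique G A) #|A|.

Definition in_L n t (G : sgraph n) : Prop :=
  connected_graph G /\ clique_number G = t.

Definition complete_multipartite n (G : sgraph n) (P : {set {set 'I_n}}) :=
  partition P [set: 'I_n] /\
  forall x y : 'I_n, G x y = (pblock P x != pblock P y).

(* T_{n,t} is determined up to isomorphism, so it is given by a predicate. *)
Definition is_turan n t (G : sgraph n) : Prop :=
  exists P : {set {set 'I_n}},
    [/\ complete_multipartite G P, #|P| = t
      & forall A B, A \in P -> B \in P -> #|A| <= #|B| + 1].

Local Open Scope ring_scope.

Definition adjmx n (G : sgraph n) : 'M[algC]_n :=
  \matrix_(i, j) (G i j)%:R.

(* Listed with multiplicity.  They are real algebraic numbers, because the
   adjacency matrix is symmetric with integer entries, so nothing is lost by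
   working in algC, whose order restricts to the usual one on the reals. *)
Definition eigenvalues n (G : sgraph n) : seq algC :=
  sval (closed_field_poly_normal (char_poly (adjmx G))).

Definition spectral_moment n (k : nat) (G : sgraph n) : algC :=
  \sum_(l <- eigenvalues G) l ^+ k.

Definition S_lt n (G1 G2 : sgraph n) : Prop :=
  exists k : nat,
    [/\ (1 <= k <= n - 1)%N,
        forall i : nat, (i < k)%N ->
          spectral_moment i G1 = spectral_moment i G2
      & spectral_moment k G1 < spectral_moment k G2].

Lemma char_poly_eigenvalues n (G : sgraph n) :
  char_poly (adjmx G) = \prod_(l <- eigenvalues G) ('X - l%:P).
Proof.
rewrite /eigenvalues; case: closed_field_poly_normal => s /= {1}->.
by rewrite (monicP (char_poly_monic _)) scale1r.
Qed.

Lemma size_eigenvalues n (G : sgraph n) : size (eigenvalues G) = n.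
Proof.
have := size_char_poly (adjmx G).
by rewrite char_poly_eigenvalues size_prod_XsubC => -[].
Qed.

Local Close Scope ring_scope.

Lemma turan_exists n t : 1 < t -> t <= n -> exists T : sgraph n, is_turan t T.
Proof.
move=> t1 tn; have t0 : 0 < t by lia.
pose c (i : 'I_n) : 'I_t := Ordinal (ltn_pmod i t0).
have s : symmetric (fun i j => c i != c j) by move=> i j; rewrite eq_sym.
have r : irreflexive (fun i j => c i != c j) by move=> i; rewrite eqxx.
exists (SGraph s r); pose P := preim_partition c [set: 'I_n].
have pP : partition P setT by apply: preim_partitionP.
have pbE x y : (y \in pblock P x) = (c x == c y).
  rewrite pblock_equivalence_partition ?inE //.
  by split=> // /eqP ->.
pose w (k : 'I_t) : 'I_n := widen_ord tn k.
have cw k : c (w k) = k by apply: val_inj => /=; rewrite modn_small.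
have tP : trivIset P by case/and3P: pP.
have cov x : x \in cover P by rewrite (cover_partition pP).
have PE : P = [set pblock P (w k) | k in 'I_t].
  apply/setP=> A; apply/idP/imsetP => [AP|[k _ ->]]; last exact: pblock_mem.
  have /set0Pn [x xA] : A != set0.
    by apply: contraTneq AP => ->; case/and3P: pP.
  exists (c x) => //; rewrite -(def_pblock tP AP xA).
  by apply: same_pblock => //; rewrite pbE cw.
exists P; split.
- by split=> // x y /=; rewrite -pbE -eq_pblock.
- rewrite PE card_imset ?card_ord // => k l /eqP.
  by rewrite eq_pblock // pbE !cw => /eqP.
move=> A B; rewrite PE => /imsetP [k _ ->] /imsetP [l _ ->].
rewrite (cardsD1 (w k)) pbE eqxx addnC leq_add2r.
have lt_l (i : 'I_n) : (i %/ t - 1) * t + l < n.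
  have := leq_divM i t; have := ltn_ord i; have := ltn_ord l; nia.
pose f i := Ordinal (lt_l i).
have Dk i : i \in pblock P (w k) :\ w k -> i = i %/ t * t + k :> nat /\ 0 < i %/ t.
  rewrite !inE pbE cw => /andP [ne /eqP e].
  have ei : i = i %/ t * t + k :> nat by rewrite e /= -divn_eq.
  split=> //; rewrite lt0n; apply: contraNneq ne => z.
  by apply/eqP/val_inj; rewrite /= ei z.
rewrite -(card_in_imset (f := f)).
  apply/subset_leq_card/subsetP => _ /imsetP [i _ ->].
  by rewrite pbE cw -val_eqE /= modnMDl modn_small.
move=> i j /Dk [ei i0] /Dk [ej j0] /(congr1 val) /= /addIn /eqP.
rewrite eqn_pmul2r // => /eqP e; apply: val_inj => /=.
by rewrite ei ej; congr (_ * _ + _); lia.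
Qed.

(* Main.v *)
Require Import Defs.
From mathcomp Require Import all_boot.
From mathcomp Require Import all_order all_fingroup all_algebra all_field.
From mathcomp Require Import ring zify.

(** The first three spectral moments of a graph on [n] vertices are [n], [0] (the
    trace of the adjacency matrix) and twice the number of edges (the trace of its
    square).  So two graphs on [n] vertices with different numbers of edges are
    separated by [S_2], and the claim is Turan's theorem: among the graphs on [n]
    vertices with clique number at most [t], the Turan graph is the only one, up
    to isomorphism, with the maximal number of edges.

    Turan's theorem is obtained in two comparisons, each with its equality case.
    First ([turan_coloring]), a graph without a clique on [t + 1] vertices has at
    most as many edges as some complete multipartite graph with at most [t] parts
    on the same vertices, with equality only if it is that graph.  Second
    ([sum_sqr_balanced]), a complete multipartite graph has [n^2] minus the sum of
    the squares of its part sizes as its number of ordered edges, and with [t]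
    parts that sum is minimal exactly when the sizes are balanced; [fibre_perm]
    turns equal size distributions into an isomorphism.

    The moments are read off in [char_poly_sqr] and [char_poly_split_trace]: the
    squares of the roots of the characteristic polynomial of [A] are the roots of
    that of [A^2], and the sum of the roots is the trace. *)

Set Implicit Arguments.
Unset Strict Implicit.
Unset Printing Implicit Defensive.
Import GRing.Theory Num.Theory.

(** * Counting edges between vertex sets *)

(** Edges are counted with orientation: [cross G setT setT] is twice the number
    of edges of [G], and is the sum of the entries of the adjacency matrix. *)
Definition cross (V : finType) (e : rel V) (A B : {set V}) : nat :=
  \sum_(x in A) \sum_(y in B) e x y.

Lemma cross_sym (V : finType) (e : rel V) (A B : {set V}) :
  symmetric e -> cross e A B = cross e B A.
Proof.
move=> sym; rewrite /cross exchange_big.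
by apply: eq_bigr => x _; apply: eq_bigr => y _; rewrite sym.
Qed.

Lemma cross_splitr (V : finType) (e : rel V) (A N S : {set V}) :
  N \subset S -> cross e A S = cross e A N + cross e A (S :\: N).
Proof.
move=> /setIidPr NS; rewrite /cross -big_split; apply: eq_bigr => x _.
by rewrite (big_setID N) NS.
Qed.

Lemma cross_split (V : finType) (e : rel V) (N S : {set V}) :
  symmetric e -> N \subset S ->
  cross e S S = cross e N N + 2 * cross e (S :\: N) N + cross e (S :\: N) (S :\: N).
Proof.
move=> sym NS; rewrite (cross_splitr _ _ NS) !(cross_sym S) //.
by rewrite !(cross_splitr _ _ NS) (cross_sym N (S :\: N)) // mul2n -addnn !addnA.
Qed.

(** The equality case is what the uniqueness half of Turan's theorem feeds on. *)
Lemma cross_leqif (V : finType) (e : rel V) (A B : {set V}) :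
  cross e A B <= #|A| * #|B|
    ?= iff [forall x in A, forall y in B, e x y].
Proof.
rewrite -sum_nat_const; apply: leqif_sum => x _.
rewrite -sum1_card; apply: leqif_sum => y _.
by case: (e x y); apply/leqifP.
Qed.

Lemma eq_cross (V : finType) (e f : rel V) (A B : {set V}) :
  {in A & B, e =2 f} -> cross e A B = cross f A B.
Proof.
by move=> ef; apply: eq_bigr => x xA; apply: eq_bigr => y yB; rewrite ef.
Qed.

Lemma crossT (V : finType) (e : rel V) :
  cross e setT setT = \sum_x \sum_y e x y.
Proof.
apply: eq_big => x; rewrite ?inE // => _.
by apply: eq_bigl => y; rewrite inE.
Qed.

(** * Majorisation by complete multipartite graphs *)

(** The complete multipartite graph whose parts are the fibres of [c]; some
    colours may be unused. *)
Definition bichromatic (V : finType) (C : eqType) (c : V -> C) : rel V :=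
  fun x y => c x != c y.

Lemma bichromatic_sym (V : finType) (C : eqType) (c : V -> C) :
  symmetric (bichromatic c).
Proof. by move=> x y; rewrite /bichromatic eq_sym. Qed.

(** Erdos's majorisation argument, by induction on [t].  Let [v] be a vertex of
    maximal degree, [N] its neighbourhood in [S] and [M] the rest of [S].  A
    clique in [N] extends by [v], so the bound on cliques is smaller by one on
    [N] and the induction hypothesis colours it; [M] receives one new colour.  Every vertex
    of [M] has degree at most that of [v], which is [#|N|], so the ordered edges
    meeting [M] number at most [2 * #|M| * #|N|], the count for a complete
    bipartite graph between [M] and [N] without edges inside [M].  Edges inside
    [M] are counted twice in the sum of the degrees, hence cost strictly: equality
    forces [M] to be independent and completely joined to [N]. *)
Lemma turan_coloring (V : finType) (e : rel V) t (S : {set V}) :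
  symmetric e -> irreflexive e ->
  (forall K : {set V}, K \subset S ->
     {in K &, forall x y, x != y -> e x y} -> #|K| <= t) ->
  exists c : V -> nat,
    [/\ {in S, forall x, c x < t},
        cross e S S <= cross (bichromatic c) S S
      & cross e S S = cross (bichromatic c) S S ->
        {in S &, e =2 bichromatic c}].
Proof.
move=> sym irr; elim: t S => [|t IH] S clq.
  exists (fun=> 0); have -> : S = set0.
    apply/setP=> x; rewrite inE; apply/negP=> xS.
    have := clq [set x]; rewrite sub1set xS cards1 => clqx.
    suff: 0 < 0 by []; apply: clqx => // a b /set1P-> /set1P->.
    by rewrite eqxx.
  split=> [x||_ x y]; rewrite ?inE //.
  by rewrite /cross !big_set0.
have [-> | [x0 x0S]] := set_0Vmem S.
  by exists (fun=> 0); split=> [x||_ x y]; rewrite ?inE // /cross !big_set0.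
pose deg x := #|[set y in S | e x y]|.
case: (arg_maxnP deg x0S) => v; rewrite -[_ v]/(v \in S) => vS vmax.
pose N := [set y in S | e v y]; pose M := S :\: N.
have NS : N \subset S by apply/subsetP=> y; rewrite inE => /andP[].
have clqN (K : {set V}) : K \subset N ->
    {in K &, forall x y, x != y -> e x y} -> #|K| <= t.
  move=> KN Kc; have vK : v \notin K.
    by apply/negP=> /(subsetP KN); rewrite inE irr andbF.
  have := clq (v |: K); rewrite cardsU1 vK /=; apply.
    by rewrite subUset sub1set vS (subset_trans KN).
  move=> x y; rewrite !inE.
  case/predU1P=> [->|xK] /predU1P [->|yK]; first by rewrite eqxx.
  - by have /(subsetP KN) := yK; rewrite inE => /andP[].
  - by have /(subsetP KN) := xK; rewrite inE sym => /andP[].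
  exact: Kc.
have [c [ct cle ceq]] := IH N clqN.
pose d x := if x \in N then c x else t.
have dN : {in N &, bichromatic d =2 bichromatic c}.
  by move=> x y xN yN; rewrite /bichromatic /d xN yN.
have dM x : x \in M -> d x = t.
  by rewrite inE /d => /andP[/negbTE-> _].
have dMN : {in M & N, bichromatic d =2 fun _ _ => true}.
  move=> x y xM yN; rewrite /bichromatic (dM x xM) /d yN.
  by have := ct _ yN; rewrite neq_ltn orbC => ->.
have dMM : {in M & M, bichromatic d =2 fun _ _ => false}.
  by move=> x y xM yM; rewrite /bichromatic !dM ?eqxx.
have cMN : cross (bichromatic d) M N = #|M| * #|N|.
  rewrite (eq_cross dMN) /cross -sum_nat_const.
  by apply: eq_bigr => x _; rewrite sum1_card.
have cMM : cross (bichromatic d) M M = 0.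
  by rewrite (eq_cross dMM) /cross big1 // => x _; rewrite big1.
(* Maximality of the degree of v enters here and nowhere else. *)
have eMS : cross e M S <= #|M| * #|N|.
  rewrite -sum_nat_const; apply: leq_sum => x; rewrite inE => /andP[_ xS].
  apply: leq_trans (vmax x xS); rewrite /deg -sum1_card.
  rewrite big_mkcond [leqRHS]big_mkcond; apply: leq_sum => y _.
  by rewrite inE; case: (y \in S); case: (e x y).
have Se := cross_split sym NS.
have Sd := cross_split (bichromatic_sym d) NS.
have Ms := cross_splitr e M NS.
rewrite -/M in Se Sd Ms; rewrite (eq_cross dN) cMN cMM in Sd.
exists d; split.
- move=> x xS; rewrite /d; case: ifP => // xN.
  by apply: leq_trans (ct x xN) _.
- by rewrite Sd Se; move: Ms eMS cle; lia.
move=> Eed.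
have [eN eMN eMM] : [/\ cross e N N = cross (bichromatic c) N N,
    cross e M N = #|M| * #|N| & cross e M M = 0].
  by move: Eed; rewrite Sd Se; move: Ms eMS cle; split; lia.
have {}eN := ceq eN.
have {}eMN : {in M & N, forall x y, e x y}.
  have [_] := cross_leqif e M N; rewrite eMN eqxx => /esym/forall_inP h.
  by move=> x y xM yN; apply: (forall_inP (h x xM)).
have {}eMM : {in M & M, forall x y, e x y = false}.
  move=> x y xM yM; move/eqP: eMM; rewrite sum_nat_eq0.
  move=> /forall_inP/(_ x xM); rewrite sum_nat_eq0.
  by move=> /forall_inP/(_ y yM); case: (e x y).
have inM x : x \in S -> x \notin N -> x \in M by rewrite in_setD => -> ->.
move=> x y xS yS; have [xN|/(inM _ xS) xM] := boolP (x \in N).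
  have [yN|/(inM _ yS) yM] := boolP (y \in N); first by rewrite dN ?eN.
  by rewrite sym bichromatic_sym eMN ?dMN.
have [yN|/(inM _ yS) yM] := boolP (y \in N); first by rewrite dMN ?eMN.
by rewrite dMM ?eMM.
Qed.

(** * Part sizes *)

(** An ordered pair of vertices is either an edge or monochromatic. *)
Lemma cross_bichromatic (V C : finType) (c : V -> C) :
  cross (bichromatic c) setT setT + \sum_i #|[set x | c x == i]| ^ 2 = #|V| ^ 2.
Proof.
transitivity (\sum_(x : V) \sum_(y : V) 1).
  have -> : cross (bichromatic c) setT setT = \sum_x \sum_y (c x != c y).
    by rewrite crossT.
  have -> : \sum_i #|[set x | c x == i]| ^ 2 = \sum_x \sum_y (c x == c y).
    rewrite (partition_big c xpredT) //=; apply: eq_bigr => i _.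
    rewrite -mulnn -sum_nat_const (eq_bigl (fun x => c x == i)).
      apply: eq_bigr => x /eqP ->; rewrite -sum1_card big_mkcond.
      by apply: eq_bigr => y _; rewrite !inE eq_sym; case: eqP.
    by move=> x; rewrite !inE.
  rewrite -big_split; apply: eq_bigr => x _; rewrite -big_split.
  by apply: eq_bigr => y _ /=; case: eqP.
by under eq_bigr do rewrite sum1_card; rewrite sum_nat_const mulnn.
Qed.

Lemma sum_card_fibres (V C : finType) (c : V -> C) :
  \sum_i #|[set x | c x == i]| = #|V|.
Proof.
rewrite -sum1_card (partition_big c xpredT) //=; apply: eq_bigr => i _.
by rewrite -sum1_card; apply: eq_bigl => x; rewrite !inE.
Qed.

(** Used twice below: to match the colours of two colourings by the sizes of
    their classes, and then to match the vertices by their colours. *)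
Lemma fibre_perm n (K : eqType) (c d : 'I_n -> K) :
  (forall k, #|[set x | c x == k]| = #|[set x | d x == k]|) ->
  exists s : {perm 'I_n}, forall x, c x = d (s x).
Proof.
move=> cd; have /tuple_permP[s cE] : perm_eq [tuple c x | x < n] [tuple d x | x < n].
  apply/allP=> k _ /=; apply/eqP; rewrite !count_map -!size_filter.
  by have := cd k; rewrite !cardsE !cardE.
exists s => x; have := congr1 (fun u => nth (c x) u x) cE.
by rewrite -!tnth_nth !tnth_mktuple.
Qed.

(** This is the integer [(x - q) * (x - (q + 1))], which is never negative and
    vanishes only at [q] and [q + 1].  Truncated subtraction leaves at most one
    of the two products nonzero. *)
Definition gap q x := (x - q.+1) * (x - q) + (q - x) * (q.+1 - x).

(** With the sum of the [a i] fixed, this turns minimising the sum of their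
    squares into minimising a sum of nonnegative gaps. *)
Lemma sum_sqr_gap (C : finType) (a : C -> nat) q :
  \sum_i a i ^ 2 + #|C| * (q * q.+1) =
  (2 * q + 1) * (\sum_i a i) + \sum_i gap q (a i).
Proof.
rewrite -sum_nat_const big_distrr /= -!big_split /=; apply: eq_bigr => i _.
rewrite /gap; case: (leqP (a i) q); nia.
Qed.

(** With [q] the least value of [b], balance puts all values of [b] in
    [{q, q + 1}], so all its gaps vanish and the sum of squares is least possible.
    In the equality case the gaps of [a] vanish too; then [a] also takes only the
    values [q] and [q + 1], and the sum of [a] determines how often each occurs. *)
Lemma sum_sqr_balanced (C : finType) (a b : C -> nat) :
  \sum_i a i = \sum_i b i -> (forall i j, b i <= b j + 1) ->
  \sum_i b i ^ 2 <= \sum_i a i ^ 2 /\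
  (\sum_i a i ^ 2 = \sum_i b i ^ 2 ->
     forall k, #|[set i | a i == k]| = #|[set i | b i == k]|).
Proof.
move=> ab bal; have [i0 _ | C0] := pickP (@predT C); last first.
  have S0 (F : C -> nat) : \sum_i F i = 0 by rewrite big1 // => i; have := C0 i.
  by split=> [|_ k]; rewrite ?S0 // !eq_card0 // => i; have := C0 i.
case: (arg_minnP b (erefl (predT i0))) => m _ minm; pose q := b m.
have bq i : gap q (b i) = 0.
  by have := minm i isT; have := bal i m; rewrite /gap -/q; nia.
have Ea := sum_sqr_gap a q; have Eb := sum_sqr_gap b q.
rewrite [\sum_i gap q (b i)]big1 // in Eb; split; first by lia.
move=> sq; have aq i : gap q (a i) = 0.
  have /eqP : \sum_i gap q (a i) = 0 by lia.
  by rewrite sum_nat_eq0 => /forallP/(_ i)/eqP.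
have val2 (f : C -> nat) : (forall i, gap q (f i) = 0) ->
    forall i, f i = q + (f i == q.+1).
  by move=> fq i; have := fq i; rewrite /gap; case: eqP; nia.
have top (f : C -> nat) : (forall i, gap q (f i) = 0) ->
    #|[set i | f i == q.+1]| + #|C| * q = \sum_i f i.
  move=> /val2 fq; rewrite (eq_bigr _ (fun i _ => fq i)) big_split /=.
  rewrite sum_nat_const addnC; congr (_ + _); rewrite -sum1_card big_mkcond.
  by apply: eq_bigr => i _; rewrite inE; case: eqP.
have bot (f : C -> nat) : (forall i, gap q (f i) = 0) ->
    #|[set i | f i == q]| + #|[set i | f i == q.+1]| = #|C|.
  move=> /val2 fq; rewrite -(cardsC [set i | f i == q.+1]) addnC; congr (_ + _).
  by apply: eq_card => i; rewrite !inE (fq i); case: eqP => /=; lia.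
have other (f : C -> nat) k : (forall i, gap q (f i) = 0) ->
    k != q -> k != q.+1 -> #|[set i | f i == k]| = 0.
  move=> /val2 fq k0 k1; apply: eq_card0 => i; rewrite !inE (fq i).
  by move: k0 k1; case: (f i == q.+1); lia.
move=> k; have := top a aq; have := top b bq; have := bot a aq; have := bot b bq.
have [-> | k0] := eqVneq k q; first by lia.
have [-> | k1] := eqVneq k q.+1; first by lia.
by move=> _ _ _ _; rewrite !other.
Qed.

(** * Turan's theorem *)

Lemma is_turan_coloring n t (T : sgraph n) : 0 < t -> is_turan t T ->
  exists d : 'I_n -> 'I_t, T =2 bichromatic d /\
    forall i j, #|[set x | d x == i]| <= #|[set x | d x == j]| + 1.
Proof.
case: t => // t _ [P [[pP TP] cP bal]].
have memP x : pblock P x \in enum P.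
  by rewrite mem_enum pblock_mem // (cover_partition pP).
have szP : size (enum P) = t.+1 by rewrite -cardE.
have idx x : index (pblock P x) (enum P) < t.+1 by rewrite -szP index_mem.
pose d x : 'I_t.+1 := Ordinal (idx x).
have fib (i : 'I_t.+1) : [set x | d x == i] = nth set0 (enum P) i.
  have Pi : nth set0 (enum P) i \in P by rewrite -mem_enum mem_nth ?szP.
  have tP : trivIset P by case/and3P: pP.
  apply/setP=> x; rewrite inE -val_eqE /=; apply/eqP/idP => [<-|xi].
    by rewrite nth_index // mem_pblock (cover_partition pP) inE.
  by rewrite (def_pblock tP Pi xi) index_uniq ?szP ?enum_uniq.
exists d; split=> [x y|i j].
  rewrite TP /bichromatic; congr (~~ _); apply/eqP/eqP => [e|[e]].
    by apply: val_inj; rewrite /= e.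
  by rewrite -[LHS](nth_index set0 (memP x)) e nth_index.
by rewrite !fib; apply: bal; rewrite -mem_enum mem_nth ?szP.
Qed.

(** Turan's theorem with uniqueness.  [turan_coloring] compares [G] with a
    complete multipartite graph having [t], possibly empty, parts;
    [sum_sqr_balanced], through the count of monochromatic pairs, compares the
    latter with [T].  If nothing is lost then [G] is that multipartite graph, and
    its parts have the same sizes as those of [T]. *)
Lemma turan_theorem n t (G T : sgraph n) :
  0 < t -> clique_number G <= t -> is_turan t T ->
  cross G setT setT <= cross T setT setT /\
  (cross G setT setT = cross T setT setT -> graph_iso G T).
Proof.
move=> t0 clqG /(is_turan_coloring t0) [d [Td bal]].
have [K _ Kc|c0 [c0t cle ceq]] := turan_coloring (t := t) (S := setT) (adj_sym G) (adj_irr G).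
  apply: leq_trans clqG; apply: leq_bigmax_cond.
  apply/forall_inP=> x xK; apply/forall_inP=> y yK; apply/implyP; exact: Kc.
pose c x : 'I_t := Ordinal (c0t x (in_setT x)).
have cc0 : bichromatic c =2 bichromatic c0 by move=> x y; rewrite /bichromatic -val_eqE.
rewrite -(eq_cross (in2W cc0)) in cle ceq.
rewrite [cross T _ _](eq_cross (in2W Td)).
have Ec := cross_bichromatic c; have Ed := cross_bichromatic d.
have [|sqle sqeq] := sum_sqr_balanced (a := fun i => #|[set x | c x == i]|) _ bal.
  by rewrite !sum_card_fibres.
have cd : cross (bichromatic c) setT setT <= cross (bichromatic d) setT setT.
  by rewrite -(leq_add2r (\sum_i #|[set x | c x == i]| ^ 2)) Ec -Ed leq_add2l.
split=> [|GT]; first exact: leq_trans cle cd.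
have cdE : cross (bichromatic c) setT setT = cross (bichromatic d) setT setT.
  by apply/eqP; rewrite eqn_leq cd -GT.
have {sqeq}[|sig sigE] := fibre_perm (sqeq _).
  by move: Ec; rewrite -Ed cdE => /addnI.
have [|s sE] := fibre_perm (c := fun x => sig (c x)) (d := d).
  move=> k; have := sigE (sig^-1%g k); rewrite permKV => <-.
  by apply: eq_card => x; rewrite !inE (can2_eq (permK sig) (permKV sig)).
exists s => [|x y]; first exact: (Bijective (permK s) (permKV s)).
by rewrite Td /bichromatic -!sE (inj_eq perm_inj) ceq ?in_setT // GT.
Qed.

(** A graph whose clique number is its order is complete. *)
Lemma cross_le_full_clique n (G T : sgraph n) :
  clique_number G = n -> cross T setT setT <= cross G setT setT.
Proof.
have [|K Kc Kn] := @eq_bigmax_cond _ (is_clique G) (fun A : {set 'I_n} => #|A|).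
  apply/card_gt0P; exists set0; rewrite unfold_in.
  by apply/forall_inP=> x; rewrite inE.
rewrite /clique_number Kn => {}Kn.
have KT : K = setT.
  by apply/eqP; rewrite eqEcard subsetT cardsT card_ord Kn /=.
move: Kc; rewrite {}KT => /forall_inP Kc.
apply: leq_sum => x _; apply: leq_sum => y _.
have [->|xy] := eqVneq x y; first by rewrite !adj_irr.
have /forall_inP/(_ y (in_setT y)) := Kc x (in_setT x).
by rewrite xy /= => ->; case: (T x y).
Qed.

(** * Spectral moments *)

Local Open Scope ring_scope.

(** [det (X^2 - A^2) = det (X - A) * det (X + A)], and the second factor is the
    first one at [- X] up to sign.  So the product of the [X^2 - a^2] is the
    characteristic polynomial of [A^2] composed with [X^2], a composition that
    can be cancelled. *)
Lemma char_poly_sqr (R : idomainType) n (A : 'M[R]_n) (s : seq R) :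
  char_poly A = \prod_(a <- s) ('X - a%:P) ->
  char_poly (A *m A) = \prod_(a <- s) ('X - (a ^+ 2)%:P).
Proof.
move=> As.
have sz : size s = n.
  by have := size_char_poly A; rewrite As size_prod_XsubC => -[].
have detD : \det ('X%:M + map_mx polyC A) = \prod_(a <- s) ('X + a%:P).
  have -> : 'X%:M + map_mx polyC A =
      -1 *: map_mx (comp_poly (- 'X)) (char_poly_mx A).
    apply/matrixP=> i j; rewrite !mxE rmorphB /= comp_polyC rmorphMn /=.
    by rewrite comp_polyX mulNrn mulN1r opprB opprK addrC.
  rewrite detZ det_map_mx -/(char_poly A) As rmorph_prod -{}sz.
  elim: (s) => [|a r IH]; first by rewrite !big_nil mulr1.
  rewrite !big_cons -IH exprS rmorphB /= comp_polyX comp_polyC.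
  ring.
apply/eqP; rewrite -subr_eq0 -(@comp_poly_eq0 _ _ 'X^2) ?size_polyXn //.
rewrite rmorphB subr_eq0 rmorph_prod /=; apply/eqP.
transitivity (char_poly A * \det ('X%:M + map_mx polyC A)).
  rewrite -det_mulmx /char_poly -det_map_mx; congr (\det _).
  set B := map_mx polyC A.
  have XB : 'X%:M *m B = B *m 'X%:M := esym (scalar_mxC _ _).
  rewrite /char_poly_mx -/B mulmxBl !mulmxDr XB opprD addrA addrK.
  rewrite -scalar_mxM map_mxB map_scalar_mx /= comp_polyX -expr2.
  congr (_ - _).
  by rewrite /B -map_mxM; apply/matrixP=> i j; rewrite !mxE comp_polyC.
rewrite As detD -big_split /=; apply: eq_bigr => a _.
rewrite rmorphB /= comp_polyX comp_polyC polyC_exp; ring.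
Qed.

Lemma char_poly_split_trace (R : idomainType) n (A : 'M[R]_n) (s : seq R) :
  char_poly A = \prod_(a <- s) ('X - a%:P) -> \sum_(a <- s) a = \tr A.
Proof.
move=> As; have sz : size s = n.
  by have := size_char_poly A; rewrite As size_prod_XsubC => -[].
case: n => [|n] in A As sz *.
  by rewrite (size0nil sz) big_nil /mxtrace big_ord0.
apply: oppr_inj; rewrite -coefPn_prod_XsubC ?sz // -As.
by rewrite -char_poly_trace.
Qed.

Lemma spectral_moment0 n (G : sgraph n) : spectral_moment 0 G = n%:R.
Proof.
rewrite /spectral_moment -[in RHS](size_eigenvalues G) -sum1_size natr_sum.
by apply: eq_bigr => x _; rewrite expr0.
Qed.

Lemma spectral_moment1 n (G : sgraph n) : spectral_moment 1 G = 0.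
Proof.
rewrite /spectral_moment; under eq_bigr do rewrite expr1.
rewrite (char_poly_split_trace (char_poly_eigenvalues G)) /mxtrace big1 // => i _.
by rewrite mxE adj_irr.
Qed.

(** The trace of the square of a symmetric 0-1 matrix is the sum of its
    entries. *)
Lemma spectral_moment2 n (G : sgraph n) :
  spectral_moment 2 G = (cross G setT setT)%:R.
Proof.
rewrite /spectral_moment; have := char_poly_sqr (char_poly_eigenvalues G).
rewrite -(big_map (fun l => l ^+ 2) predT (fun l => 'X - l%:P)).
move/char_poly_split_trace; rewrite big_map => ->.
rewrite crossT natr_sum; apply: eq_bigr => i _.
rewrite natr_sum mxE; apply: eq_bigr => j _.
by rewrite !mxE [G j i]adj_sym; case: (G i j); rewrite ?mulr1 ?mulr0.
Qed.

Local Close Scope ring_scope.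

Theorem theorem3p2 (n t : nat) (ht : 1 < t) (htn : t <= n)
    (T : sgraph n) (hT : is_turan t T)
    (G : sgraph n) (hG : in_L t G) (hGT : ~ graph_iso G T) :
  S_lt G T.
Proof.
have [_ clqG] := hG.
have [le_GT eq_GT] : cross G setT setT <= cross T setT setT /\
    (cross G setT setT = cross T setT setT -> graph_iso G T).
  by apply: (turan_theorem (t := t)); rewrite ?clqG ?(ltnW ht).
have lt_GT : cross G setT setT < cross T setT setT.
  by rewrite ltn_neqAle le_GT andbT; apply/eqP=> /eq_GT.
(* The second moment is admissible only if 2 <= n - 1.  For n = 2 the clique
   number is 2 as well, so G is complete and cannot have fewer edges than T. *)
have n3 : 2 < n.
  rewrite ltn_neqAle (leq_trans ht htn) andbT; apply/eqP=> n2.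
  have tn : t = n by lia.
  by have := cross_le_full_clique T (etrans clqG tn); rewrite leqNgt lt_GT.
exists 2; split; first by lia.
  by case=> [|[|i]] // _; rewrite ?spectral_moment0 ?spectral_moment1.
by rewrite !spectral_moment2 ltr_nat.
Qed.
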